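(* Let $F\colon\mathbb{N}\to(0,\infty)$ satisfy $\sum_{k=1}^\infty \frac{1}{F(k)}<\infty$, and let $(\Xi(t))_{t\ge0}$ be the pure birth process with rate function $F$ and deterministic initial value $\Xi(0)\in\mathbb{N}$, with explosion time $T$ having density $g$. Then for every $t>0$, $$\mathbb{P}(\Xi(t)=x)\sim \frac{g(t)}{F(x)}\quad\text{as }x\to\infty,$$ and for any $t_0>0$ this convergence is uniform in $t>t_0$. Consequently, for every $t>0$, $$\mathbb{P}(\Xi(t)>x\mid T>t)\sim -\frac{d}{dt}\log\big(\mathbb{P}(T>t)\big)\sum_{k=x+1}^\infty\frac{1}{F(k)}\quad\text{as }x\to\infty.$$
   Context: $\mathbb{N}=\{1,2,\dots\}$. Given $F\colon\mathbb{N}\to(0,\infty)$ and $\Xi(0)\in\mathbb{N}$, let $\tau(k)$, $k\ge\Xi(0)$, be independent random variables with $\tau(k)$ exponentially distributed with rate $F(k)$ (mean $1/F(k)$). The birth process is $\Xi(t)=\min\{k\in\mathbb{N}:\sum_{l=\Xi(0)}^k\tau(l)>t\}$ for $t\ge0$ (with $\min\emptyset=\infty$); it jumps from $k$ to $k+1$ at rate $F(k)$. Its explosion time is $T=\sum_{k=\Xi(0)}^\infty\tau(k)$, which is a.s. finite under the summability assumption and has a density $g$. For sequences, $x_k\sim y_k$ means $x_k/y_k\to1$.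
   Formalization: The density g of T is taken to be the version that is continuous on (0,∞): a density is determined only almost everywhere, and altering g at a single t would make the pointwise claim false there; existence of this continuous version is assumed, not proved. *)

(* Defs.v *)
From HB Require Import structures.
From mathcomp Require Import all_boot all_order all_algebra.
From mathcomp Require Import all_classical all_reals all_analysis.
Set Implicit Arguments. Unset Strict Implicit. Unset Printing Implicit Defensive.
Import Order.TTheory GRing.Theory Num.Theory.
Import numFieldNormedType.Exports.
Local Open Scope classical_set_scope.
Local Open Scope ring_scope.

Definition birth_S {d} {Omega : measurableType d} {R : realType}
  (Xi0 : nat) (tau : nat -> Omega -> R) (k : nat) (w : Omega) : R :=
  \sum_(Xi0 <= l < k.+1) tau l w.

Definition birth_Xi_is {d} {Omega : measurableType d} {R : realType}
  (Xi0 : nat) (tau : nat -> Omega -> R) (t : R) (x : nat) (w : Omega) : Prop :=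
  [/\ (1 <= x)%N, t < birth_S Xi0 tau x w &
      forall k, (1 <= k < x)%N -> ~ (t < birth_S Xi0 tau k w)].

Definition birth_T {d} {Omega : measurableType d} {R : realType}
  (Xi0 : nat) (tau : nat -> Omega -> R) (w : Omega) : \bar R :=
  (\sum_(Xi0 <= k <oo) (tau k w)%:E)%E.

Definition mutually_independent_from {d} {Omega : measurableType d} {R : realType}
  (P : probability Omega R) (Xi0 : nat) (tau : nat -> Omega -> R) : Prop :=
  forall (I : seq nat) (B : nat -> set R),
    uniq I -> all (fun i => (Xi0 <= i)%N) I ->
    (forall i, i \in I -> measurable (B i)) ->
    P (\bigcap_(i in [set` I]) (tau i @^-1` B i)) =
    (\prod_(i <- I) P (tau i @^-1` B i))%E.

(* Main.v *)
(* [Xi0 + n] is occupied at time [t] iff the sum of the first [n] holding times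
   is at most [t] and that of the first [n + 1] is not.  Hence, with [a n] the
   rate [F (Xi0 + n)] and [f n] the density of the sum of the first [n + 1]
   holding times, [P (Xi t = Xi0 + n) = f n t / a n], and the claim is that
   [f n / g] tends to 1 uniformly on [t0, +oo[.

   The forward equations [f_(n+1)' = a_(n+1) (f_n - f_(n+1))] give, by induction
   on [n], that the logarithmic derivative of [f n] is nonincreasing in [t] and
   nondecreasing in [n].  So [f_m / f_n] is nondecreasing in [t] for [n <= m],
   and so is [g / f_n]: on [t0, +oo[ the ratio [f_n / g] is at most its value at
   [t0], where pointwise convergence suffices.  Moreover the logarithmic
   derivatives are at least [- a 0], so that [f_n / g] is at least
   [1 - a 0 * \sum_(k > n) 1 / a k] for every [t > 0]. *)
Require Import Defs.
From HB Require Import structures.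
From mathcomp Require Import all_boot all_order all_algebra.
From mathcomp Require Import all_classical all_reals all_analysis.
From mathcomp Require Import measurable_realfun ring lra.
Set Implicit Arguments. Unset Strict Implicit. Unset Printing Implicit Defensive.
Import Order.TTheory GRing.Theory Num.Theory.
Import numFieldNormedType.Exports.
Local Open Scope classical_set_scope.
Local Open Scope ring_scope.

(** * Forward equations and logarithmic derivatives *)

Lemma continuous_expRM (R : realType) (c : R) : continuous (fun u : R => expR (c * u)).
Proof.
move=> u; apply: (@continuous_comp _ _ _ (fun u => c * u)).
  by apply: cvgM; [exact: cvg_cst|exact: cvg_id].
exact: continuous_expR.
Qed.

(** [expR (c * x)] is an integrating factor: it turns [df + c f] into a derivative, to which the
    mean value theorem applies. *)
Lemma expRM_MVT (R : realType) (c : R) (f df : R -> R) (a b : R) : a < b ->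
  {within `[a, b], continuous f} ->
  (forall x, a < x < b -> is_derive x 1 f (df x)) ->
  exists2 x, a < x < b &
    expR (c * b) * f b - expR (c * a) * f a
    = expR (c * x) * (df x + c * f x) * (b - a).
Proof.
move=> ab cf fdf.
pose ef x := expR (c * x) * f x.
have dexp (x : R) : is_derive x 1 (fun x : R => expR (c * x)) (c * expR (c * x)).
  by apply: is_derive_eq; rewrite /GRing.scale/=; ring.
have def (x : R) : x \in `]a, b[ -> is_derive x 1 ef (expR (c * x) * (df x + c * f x)).
  move=> xab; have := fdf x xab => dfx.
  by apply: is_derive_eq; rewrite /GRing.scale/=; ring.
have [|x xab ->] := MVT ab def.
  have cexp : {within `[a, b], continuous (fun x => expR (c * x))}.
    exact/continuous_subspaceT/continuous_expRM.
  by move=> x; apply: cvgM; [exact: cexp|exact: cf].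
by exists x.
Qed.

(** Comparison principle for the differential inequalities below. Derivatives are asked for only
    inside the interval because its left end may be 0, where a density may have a corner. *)
Lemma expRM_nondecreasing (R : realType) (c : R) (f df : R -> R) (a b : R) :
  a <= b -> {within `[a, b], continuous f} ->
  (forall x, a < x < b -> is_derive x 1 f (df x)) ->
  (forall x, a < x < b -> 0 <= df x + c * f x) ->
  expR (c * a) * f a <= expR (c * b) * f b.
Proof.
rewrite le_eqVlt => /predU1P[<-//|ab] cf fdf df0.
have [x xab fab] := expRM_MVT c ab cf fdf.
by rewrite -subr_ge0 fab !mulr_ge0 ?expR_ge0 ?df0// subr_ge0 ltW.
Qed.

Section convolution_densities.
Context {R : realType} (a : nat -> R) (f : nat -> R -> R).
Hypothesis a_gt0 : forall n, 0 < a n.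
Hypothesis f_cont : forall n, continuous (f n).
Hypothesis f0_gt0 : 0 < f 0 0.
Hypothesis fS0 : forall n, f n.+1 0 = 0.
Hypothesis f0_derive : forall t : R, 0 < t -> is_derive t 1 (f 0) (- a 0 * f 0 t).
Hypothesis fS_derive : forall n (t : R), 0 < t ->
  is_derive t 1 (f n.+1) (a n.+1 * (f n t - f n.+1 t)).

Let f_within n (A : set R) : {within A, continuous (f n)}.
Proof. exact: continuous_subspaceT. Qed.

(** With the integrating factor, the forward equation leaves only [a n.+1 * f n] as source term, so
    positivity passes from [f n] to [f n.+1]; strictness comes from the mean value theorem. *)
Lemma density_gt0 n (t : R) : 0 < t -> 0 < f n t.
Proof.
elim: n t => [|n IHn] t t0.
  have : expR (a 0 * 0) * f 0 0 <= expR (a 0 * t) * f 0 t.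
    apply: (@expRM_nondecreasing _ _ _ (fun x => - a 0 * f 0 x)) => //.
    - exact: ltW.
    - by move=> x /andP[x0 _]; exact: f0_derive.
    - by move=> x _; rewrite mulNr addNr.
  rewrite mulr0 expR0 mul1r => /(lt_le_trans f0_gt0).
  by rewrite pmulr_rgt0 ?expR_gt0.
have [||x /andP[x0 _]] := @expRM_MVT _ (a n.+1) (f n.+1)
    (fun x => a n.+1 * (f n x - f n.+1 x)) 0 t t0.
- exact: f_within.
- by move=> x /andP[x0 _]; exact: fS_derive.
- rewrite fS0 mulr0 2!subr0 -mulrDr subrK => ft.
  rewrite -(pmulr_rgt0 _ (expR_gt0 (a n.+1 * t))) ft.
  by rewrite !mulr_gt0 ?expR_gt0 ?IHn.
Qed.

(** Equals [f_n' / f_n] for [t > 0], written through the forward equation: for [n = m.+1] it depends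
    on [t] only through [f m t / f n t], so its monotonicity is that of a ratio of consecutive
    densities. *)
Definition log_derivative n (t : R) : R :=
  if n is m.+1 then a n * (f m t / f n t - 1) else - a 0.

Local Notation phi := log_derivative.

Lemma log_derivativeE n (t : R) : 0 < t -> is_derive t 1 (f n) (phi n t * f n t).
Proof.
case: n => [|n] t0; first exact: f0_derive.
have fn := density_gt0 n.+1 t0.
have := fS_derive n t0; congr is_derive.
by rewrite /phi -mulrA mulrBl mul1r divfK// gt_eqF.
Qed.

(* With [c] the value of [phi n] at [t], the function
   [a f_n - (a + c) f_(n+1)] of [u], where [a] is [a n.+1], has derivative at
   least [- a] times itself on ]0, t[, because [phi n] is at least [c] there. *)
Lemma log_derivative_leS n t : 0 < t ->
  (forall u, 0 < u <= t -> phi n t <= phi n u) -> phi n t <= phi n.+1 t.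
Proof.
move=> t0 phi_t.
set c := phi n t; set b := a n.+1.
pose psi := (fun u => b * f n u - (b + c) * f n.+1 u).
have psi0 : 0 <= psi 0.
  rewrite /psi fS0 mulr0 subr0 mulr_ge0 ?(ltW (a_gt0 _))//.
  by case: n {phi_t c b psi} => [|n]; rewrite ?fS0// ltW.
have : expR (b * 0) * psi 0 <= expR (b * t) * psi t.
  apply: (@expRM_nondecreasing _ _ _ (fun u => b * (phi n u * f n u)
    - (b + c) * (b * (f n u - f n.+1 u)))) => //.
  - exact: ltW.
  - apply: continuous_subspaceT => x; rewrite /psi.
    by apply: cvgB; apply: cvgM; [exact: cvg_cst|exact: f_cont|exact: cvg_cst|exact: f_cont].
  - move=> u /andP[u0 _]; rewrite /psi.
    have df := log_derivativeE n u0.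
    have dfS := fS_derive n u0.
    by apply: is_derive_eq; rewrite /GRing.scale/= -/b; ring.
  - move=> u /andP[u0 ut].
    have -> : b * (phi n u * f n u) - (b + c) * (b * (f n u - f n.+1 u))
      + b * psi u = b * (f n u * (phi n u - c)) by rewrite /psi; ring.
    rewrite mulr_ge0 ?(ltW (a_gt0 _))// mulr_ge0 ?(ltW (density_gt0 _ u0))//.
    by rewrite subr_ge0 phi_t// u0 ltW.
rewrite mulr0 expR0 mul1r => /(le_trans psi0).
rewrite pmulr_rge0 ?expR_gt0// /psi subr_ge0 /= -/b.
have fS : 0 < f n.+1 t by exact: density_gt0.
by rewrite -ler_pdivlMr// -mulrA; lra.
Qed.

(** The ratio has logarithmic derivative [phi n.+1 - phi n]. The order of the two is a hypothesis
    because the lemma serves inside the induction that establishes this order. *)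
Lemma density_ratio_nondecreasing n s t : 0 < s -> s <= t ->
  (forall u, 0 < u -> phi n u <= phi n.+1 u) ->
  f n.+1 s / f n s <= f n.+1 t / f n t.
Proof.
move=> s0 st phiS.
have t0 := lt_le_trans s0 st.
have dq (u : R) : 0 < u -> is_derive u 1 (fun u => f n.+1 u / f n u)
    ((phi n.+1 u - phi n u) * (f n.+1 u / f n u)).
  move=> u0; have fn : f n u != 0 by rewrite gt_eqF// density_gt0.
  have df := log_derivativeE n u0.
  have dfS := log_derivativeE n.+1 u0.
  move: (phi n.+1 u) (phi n u) df dfS => p q df dfS.
  apply: (is_derive_eq (is_deriveM dfS (is_deriveV fn df))).
  by rewrite /GRing.scale/=; field.
have := @expRM_nondecreasing _ 0 (fun u => f n.+1 u / f n u)
  (fun u => (phi n.+1 u - phi n u) * (f n.+1 u / f n u)) s t st.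
rewrite !mul0r expR0 !mul1r; apply.
- apply: continuous_in_subspaceT => u; rewrite inE/= in_itv/= => /andP[su _].
  have u0 := lt_le_trans s0 su.
  have := dq u u0 => dqu.
  exact/differentiable_continuous/derivable1_diffP.
- by move=> u /andP[su _]; apply: dq; exact: lt_trans su.
- move=> u /andP[su _]; have u0 := lt_trans s0 su.
  rewrite mul0r addr0 mulr_ge0 ?subr_ge0 ?phiS//.
  by rewrite divr_ge0 ?ltW ?density_gt0.
Qed.

(** The induction closes here: [phi n] nonincreasing gives [phi n <= phi n.+1], so [f n.+1 / f n] is
    nondecreasing, and [phi n.+1] is an increasing function of the inverse ratio. *)
Lemma log_derivative_nonincreasing n s t : 0 < s -> s <= t ->
  phi n t <= phi n s.
Proof.
elim: n s t => [//|n IHn] s t s0 st.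
have t0 := lt_le_trans s0 st.
rewrite /= ler_pM2l// lerD2r.
rewrite -(invf_div (f n.+1 t)) -(invf_div (f n.+1 s)).
rewrite lef_pV2 ?posrE ?divr_gt0 ?density_gt0//.
apply: density_ratio_nondecreasing => // u u0.
by apply: log_derivative_leS => // v /andP[v0 vu]; exact: IHn.
Qed.

Lemma log_derivativeS n t : 0 < t -> phi n t <= phi n.+1 t.
Proof.
move=> t0; apply: log_derivative_leS => // u /andP[u0 ut].
exact: log_derivative_nonincreasing.
Qed.

Lemma log_derivative_ge n t : 0 < t -> - a 0 <= phi n t.
Proof.
move=> t0; elim: n => [|n IHn]; first exact: lexx.
exact: le_trans IHn (log_derivativeS n t0).
Qed.

(** The quotient is a product of ratios of consecutive densities, each nonnegative and
    nondecreasing. *)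
Lemma density_quotient_nondecreasing n m s t : (n <= m)%N -> 0 < s -> s <= t ->
  f m s / f n s <= f m t / f n t.
Proof.
move=> nm s0 st; have t0 := lt_le_trans s0 st.
rewrite -(subnKC nm); elim: (m - n)%N => [|k IHk].
  by rewrite addn0 !divff// gt_eqF ?density_gt0.
have qE u : 0 < u -> f (n + k.+1) u / f n u =
    (f (n + k).+1 u / f (n + k) u) * (f (n + k) u / f n u).
  by move=> u0; rewrite addnS mulrA divfK// gt_eqF ?density_gt0.
rewrite !qE// ler_pM//; try by rewrite divr_ge0// ltW// density_gt0.
by apply: density_ratio_nondecreasing => // u; exact: log_derivativeS.
Qed.

(** Integrated form of [- a 0 <= phi n]. The factor does not depend on [n], which gives control of
    all densities at once in the passage to the limit. *)
Lemma expRM_density_nondecreasing n s t : 0 < s -> s <= t ->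
  expR (a 0 * s) * f n s <= expR (a 0 * t) * f n t.
Proof.
move=> s0 st.
apply: (@expRM_nondecreasing _ _ _ (fun u => phi n u * f n u)) => //.
- by move=> u /andP[su _]; apply: log_derivativeE; exact: lt_trans su.
- move=> u /andP[su _]; have u0 := lt_trans s0 su.
  rewrite -mulrDl mulr_ge0 ?(ltW (density_gt0 _ u0))//.
  by have := log_derivative_ge n u0; lra.
Qed.

(** The bound [- a 0 <= phi n.+1], solved for [f n t]. *)
Lemma densityS_le n t : 0 < t -> (1 - a 0 / a n.+1) * f n.+1 t <= f n t.
Proof.
move=> t0; have := log_derivative_ge n.+1 t0 => /=.
have fS := density_gt0 n.+1 t0; have an := a_gt0 n.+1.
rewrite -(ler_pM2r fS) -mulrA mulrBl divfK ?gt_eqF// mul1r => phi_ge.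
by rewrite -(ler_pM2l an) mulrA mulrBr mulr1 mulrCA mulfV ?gt_eqF//; lra.
Qed.

(** Iterates [densityS_le]; the assumption on the sum keeps the factors met on the way
    nonnegative. *)
Lemma density_le n m t : (n <= m)%N -> 0 < t ->
  a 0 * \sum_(n.+1 <= k < m.+1) (a k)^-1 <= 1 ->
  (1 - a 0 * \sum_(n.+1 <= k < m.+1) (a k)^-1) * f m t <= f n t.
Proof.
move=> nm t0; rewrite -(subnKC nm); elim: (m - n)%N => [|k IHk].
  by rewrite addn0 big_geq// mulr0 subr0 mul1r.
rewrite addnS big_nat_recr/= ?ltnS ?leq_addr//.
set s := \sum_(_ <= _ < _) _ in IHk *; set b := a (n + k).+1.
have b0 : 0 < b^-1 by rewrite invr_gt0 a_gt0.
have a0 := a_gt0 0.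
have s0 : 0 <= s by rewrite sumr_ge0// => i _; rewrite invr_ge0 ltW.
have ab0 : 0 < a 0 * b^-1 by rewrite mulr_gt0.
have as0 : 0 <= a 0 * s by rewrite mulr_ge0 ?(ltW a0).
rewrite mulrDr => sb.
apply: le_trans (IHk _); last lra.
(* [(1 - x) * (1 - y) >= 1 - x - y] for nonnegative [x] and [y] turns the product of factors into a
   sum. *)
apply: le_trans (_ : (1 - a 0 * s) * ((1 - a 0 / b) * f (n + k).+1 t) <= _).
  rewrite mulrA ler_wpM2r ?(ltW (density_gt0 _ t0))//.
  have := mulr_ge0 as0 (ltW ab0).
  by move: (a 0 * s) (a 0 * b^-1) => x y; lra.
by rewrite ler_wpM2l ?densityS_le//; lra.
Qed.

(* The affine minorant, shifted right by the mean [1 / a k] at each step, is a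
   subsolution of the forward equations. *)
Lemma density_ge_affine n m t beta b : (n <= m)%N -> 0 <= t -> 0 <= beta -> 0 <= b ->
  (forall u, 0 <= u <= t -> beta * (u - b) <= f n u) ->
  forall u, 0 <= u <= t ->
    beta * (u - (b + \sum_(n.+1 <= k < m.+1) (a k)^-1)) <= f m u.
Proof.
move=> nm t0 beta0 b0 fn; rewrite -(subnKC nm); elim: (m - n)%N => [|k IHk] u.
  by rewrite addn0 big_geq// addr0; exact: fn.
rewrite addnS big_nat_recr/= ?ltnS ?leq_addr// addrA.
set s := \sum_(_ <= _ < _) _ in IHk *; set c := a (n + k).+1.
move=> /andP[u0 ut].
have c0 : 0 < c by exact: a_gt0.
have s0 : 0 <= s by rewrite sumr_ge0// => i _; rewrite invr_ge0 ltW.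
pose psi u := f (n + k).+1 u - beta * (u - (b + s + c^-1)).
suff : expR (c * 0) * psi 0 <= expR (c * u) * psi u.
  rewrite mulr0 expR0 mul1r => psi0.
  have : 0 <= psi 0.
    rewrite /psi fS0 2!sub0r mulrN opprK mulr_ge0// !addr_ge0// invr_ge0 ltW//.
  move=> /le_trans /(_ psi0); rewrite pmulr_rge0 ?expR_gt0//.
  by rewrite /psi subr_ge0.
apply: (@expRM_nondecreasing _ _ _
    (fun u => c * (f (n + k) u - f (n + k).+1 u) - beta)) => //.
- apply: continuous_subspaceT => x; rewrite /psi.
  apply: cvgB; first exact: f_cont.
  by apply: cvgM; [exact: cvg_cst|apply: cvgB; [exact: cvg_id|exact: cvg_cst]].
- move=> x /andP[x0 _]; have dfS := fS_derive (n + k) x0.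
  by rewrite /psi; apply: is_derive_eq; rewrite /GRing.scale/= -/c; ring.
- move=> x /andP[x0 xu].
  have := IHk x; rewrite (ltW x0) (ltW (lt_le_trans xu ut)) => /(_ isT) fx.
  (* The shift by [c^-1] contributes exactly [beta], which cancels the derivative of the affine
     part. *)
  have -> : c * (f (n + k) x - f (n + k).+1 x) - beta + c * psi x =
      c * (f (n + k) x - beta * (x - (b + s))).
    by rewrite /psi; field; rewrite gt_eqF.
  by rewrite mulr_ge0 ?(ltW c0)// subr_ge0.
Qed.


(** * Passage to the limit density *)

Section limit.
(** [H n] stands for the distribution function of the sum of the first [n.+1] holding times, [G] and
    [g] for the distribution function and density of the explosion time, [r n] for a tail of the
    series of mean holding times. *)
Context (H : nat -> R -> R) (G g : R -> R) (r : nat -> R).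
Hypothesis H_derive : forall n (t : R), 0 < t -> is_derive t 1 (H n) (f n t).
Hypothesis H_cvg : forall t, 0 < t -> H n t @[n --> \oo] --> G t.
Hypothesis G_derive : forall t : R, 0 < t -> is_derive t 1 G (g t).
Hypothesis r_cvg : forall n,
  (fun m => \sum_(n.+1 <= k < m.+1) (a k)^-1) @ \oo --> r n.
Hypothesis r_cvg0 : r @ \oo --> 0.

Let sum_le_r n m : \sum_(n.+1 <= k < m.+1) (a k)^-1 <= r n.
Proof.
apply: (cvgr_to_ge (@r_cvg n)); exists m => //= p /= mp.
have [nm|mn] := leqP n.+1 m.+1; last first.
  rewrite (big_geq (m := n.+1) (n := m.+1)); last exact: ltnW.
  by rewrite sumr_ge0// => i _; rewrite invr_ge0 ltW.
rewrite [leRHS](big_cat_nat _ (n := m.+1))//= lerDl.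
by rewrite sumr_ge0// => i _; rewrite invr_ge0 ltW.
Qed.

Let r_gt0 n : 0 < r n.
Proof.
apply: lt_le_trans (sum_le_r n n.+1).
by rewrite big_nat1 invr_gt0.
Qed.

(* [Q K h] is a damped difference quotient of [K] at [t]; the monotonicity of
   [expR (a 0 * t) * f n t] puts [f n t] between [Q (H n) h] for [h < 0] and for
   [h > 0]. *)
Lemma density_cvg t : 0 < t -> f n t @[n --> \oo] --> g t.
Proof.
move=> t0.
pose Q (K : R -> R) h := expR (a 0 * h) * (h^-1 * (K (h + t) - K t)).
have QG : Q G h @[h --> 0^'] --> g t.
  suff : Q G h @[h --> 0^'] --> expR (a 0 * 0) * g t by rewrite mulr0 expR0 mul1r.
  rewrite /Q; apply: cvgM.
    apply: cvg_trans (@continuous_expRM _ (a 0) (0 : R)).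
    by apply: cvg_app; exact: cvg_within.
  have dG := G_derive t0.
  have : h^-1 *: (G (h *: 1 + t) - G t) @[h --> 0^'] --> g t.
    by rewrite -(@derive_val _ _ _ _ _ _ _ dG); exact: ex_derive.
  by under eq_fun do rewrite [_ *: 1]mulr1.
have QH h : - t < h -> Q (H n) h @[n --> \oo] --> Q G h.
  move=> th; have ht0 : 0 < h + t by lra.
  rewrite /Q; apply: cvgM; first exact: cvg_cst.
  apply: cvgM; first exact: cvg_cst.
  by apply: cvgB; exact: H_cvg.
have H_within n x y : 0 < x -> {within `[x, y], continuous (H n)}.
  move=> x0; apply: continuous_in_subspaceT => u.
  rewrite inE/= in_itv/= => /andP[xu _].
  have dH := H_derive n (lt_le_trans x0 xu).
  exact/differentiable_continuous/derivable1_diffP.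
have QH_ge n h : 0 < h -> f n t <= Q (H n) h.
  move=> h0.
  have [|x /[!in_itv]/= /andP[tx xh]||y /[!in_itv]/= /andP[ty yh]] :=
    @MVT _ (H n) (f n) t (h + t).
  - by rewrite ltrDr.
  - by apply: H_derive; exact: lt_trans tx.
  - exact: H_within.
  rewrite addrK => Hy; rewrite /Q Hy [f n y * h]mulrC mulKf ?gt_eqF//.
  (* Multiplied by [expR (a 0 * t)], the damping factor becomes [expR (a 0 * (t + h))], which
     dominates [expR (a 0 * y)]. *)
  rewrite -(ler_pM2l (expR_gt0 (a 0 * t))) mulrA -expRD.
  apply: le_trans (expRM_density_nondecreasing n t0 (ltW ty)) _.
  rewrite ler_wpM2r ?(ltW (density_gt0 _ (lt_trans t0 ty)))//.
  by rewrite ler_expR -mulrDr ler_wpM2l ?(ltW (a_gt0 _))// addrC ltW.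
have QH_le n h : h < 0 -> - t < h -> Q (H n) h <= f n t.
  move=> h0 th; have th0 : 0 < h + t by lra.
  have [|x /[!in_itv]/= /andP[tx xh]||y /[!in_itv]/= /andP[ty yt] Hy] :=
    @MVT _ (H n) (f n) (h + t) t.
  - by lra.
  - by apply: H_derive; exact: lt_trans tx.
  - exact: H_within.
  have y0 := lt_trans th0 ty.
  have HE : H n (h + t) - H n t = h * f n y by rewrite -opprB Hy; ring.
  rewrite /Q HE mulKf ?lt_eqF//.
  rewrite -(ler_pM2l (expR_gt0 (a 0 * t))) mulrA -expRD.
  apply: le_trans (expRM_density_nondecreasing n y0 (ltW yt)).
  rewrite ler_wpM2r ?(ltW (density_gt0 _ y0))//.
  by rewrite ler_expR -mulrDr ler_wpM2l ?(ltW (a_gt0 _))// addrC ltW.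
apply/cvgrPdist_lt => e e0.
move/cvgrPdist_lt : QG => /(_ _ e0)[d /= d0 dQ].
(* [h < d] puts both quotients of [G], at [h] and at [- h], within [e] of [g t]; [h < t] keeps
   [t - h] positive. *)
pose h := Num.min (d / 2) (t / 2).
have h0 : 0 < h by rewrite lt_min !divr_gt0.
have hd : h < d by rewrite gt_min; apply/orP; left; lra.
have ht : h < t by rewrite gt_min; apply/orP; right; lra.
have := dQ h; rewrite /= sub0r normrN gtr0_norm// gt_eqF// => /(_ hd isT) Qh.
have := dQ (- h); rewrite /= sub0r normrN normrN gtr0_norm// oppr_eq0 gt_eqF//.
move=> /(_ hd isT) QNh.
have Qlt : Q G h < g t + e by move: Qh; rewrite ltr_norml => /andP[]; lra.
have Qgt : g t - e < Q G (- h) by move: QNh; rewrite ltr_norml => /andP[]; lra.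
have th : - t < h by lra.
have tNh : - t < - h by lra.
near=> n; rewrite ltr_norml; apply/andP; split.
- have : Q (H n) h < g t + e by near: n; exact: (cvgr_lt _ (QH _ th) _ Qlt).
  by have := QH_ge n _ h0; lra.
- have : g t - e < Q (H n) (- h) by near: n; exact: (cvgr_gt _ (QH _ tNh) _ Qgt).
  have := QH_le n (- h); rewrite oppr_lt0 => /(_ h0 tNh); lra.
Unshelve. all: by end_near. Qed.

(** A limit of positive functions could vanish; an affine minorant prevents it. Once [r n <= t / 4],
    a line that vanishes at [t / 2] lies below [f n] on [0, t]. It moves right by at most [t / 4] on
    the way to any later [f m], so its value at [t] stays bounded away from 0. *)
Lemma limit_gt0 t : 0 < t -> 0 < g t.
Proof.
move=> t0.
have t40 : 0 < t / 4 by rewrite divr_gt0.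
have [n _ /(_ n (leqnn n))/= rn] := cvgr_le _ r_cvg0 _ t40.
(* A lower bound of [f n] on [t / 2, t], by the monotonicity of [expR (a 0 * u) * f n u]. *)
set c := expR (- (a 0 * t)) * (expR (a 0 * (t / 2)) * f n (t / 2)).
have t20 : 0 < t / 2 by rewrite divr_gt0.
have c0 : 0 < c by rewrite !mulr_gt0 ?expR_gt0 ?density_gt0.
have cf u : t / 2 <= u <= t -> c <= f n u.
  move=> /andP[tu ut]; rewrite /c expRN ler_pdivrMl ?expR_gt0//.
  apply: le_trans (expRM_density_nondecreasing n t20 tu) _.
  rewrite ler_wpM2r ?(ltW (density_gt0 _ (lt_le_trans t20 tu)))//.
  by rewrite ler_expR ler_wpM2l ?(ltW (a_gt0 _)).
(* The slope with which the line from 0 at [t / 2] reaches [c] at [t]. *)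
set beta := c / (t / 2).
have beta0 : 0 < beta by rewrite divr_gt0.
have fn u : 0 <= u <= t -> beta * (u - t / 2) <= f n u.
  move=> /andP[u0 ut]; have [tu|ut2] := leP (t / 2) u.
    apply: le_trans (cf u _); last by rewrite tu.
    by rewrite /beta mulrAC ler_pdivrMr// ler_wpM2l ?(ltW c0)//; lra.
  apply: (@le_trans _ _ 0); first by rewrite pmulr_rle0//; lra.
  move: u0; rewrite le_eqVlt => /predU1P[<-|u0]; last exact/ltW/density_gt0.
  by case: (n) => [|k]; rewrite ?fS0// ltW.
apply: (@lt_le_trans _ _ (beta * (t / 4))); first by rewrite mulr_gt0.
apply: (cvgr_to_ge (density_cvg t0) _); exists n => //= m /= nm.
have := density_ge_affine nm (ltW t0) (ltW beta0) (ltW t20) fn.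
move=> /(_ t); rewrite lexx (ltW t0) => /(_ isT); apply: le_trans.
by rewrite ler_wpM2l ?(ltW beta0)//; have := sum_le_r n m; lra.
Qed.

(** The limit of [density_le] as [m] tends to infinity. *)
Lemma limit_le n t : 0 < t -> a 0 * r n <= 1 -> (1 - a 0 * r n) * g t <= f n t.
Proof.
move=> t0 ar1; apply: (@cvgr_to_le _ \oo _ _
  (fun m => (1 - a 0 * \sum_(n.+1 <= k < m.+1) (a k)^-1) * f m t)).
  apply: cvgM; last exact: density_cvg.
  by apply: cvgB; [exact: cvg_cst|apply: cvgM; [exact: cvg_cst|exact: (@r_cvg)]].
exists n => //= m /= nm; apply: density_le => //.
by apply: le_trans ar1; rewrite ler_wpM2l ?(ltW (a_gt0 _)).
Qed.

Lemma limit_quotient_nondecreasing n s t : 0 < s -> s <= t ->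
  g s / f n s <= g t / f n t.
Proof.
move=> s0 st; have t0 := lt_le_trans s0 st.
apply: (@ler_cvg_to _ \oo _ _ (fun m => f m s / f n s) (fun m => f m t / f n t)).
- by apply: cvgM; [exact: density_cvg|exact: cvg_cst].
- by apply: cvgM; [exact: density_cvg|exact: cvg_cst].
- by exists n => //= m /= nm; exact: density_quotient_nondecreasing.
Qed.

Lemma density_cvg_uniform t0 e : 0 < t0 -> 0 < e -> exists N, forall n t,
  (N <= n)%N -> t0 <= t -> `|f n t / g t - 1| < e.
Proof.
move=> t00 e0; have g0 := limit_gt0 t00.
have : f n t0 / g t0 @[n --> \oo] --> (1 : R).
  rewrite -[1](@mulfV _ (g t0)) ?gt_eqF//.
  by apply: cvgM; [exact: density_cvg|exact: cvg_cst].
(* Below this threshold [a 0 * r n] is less than 1, so that [limit_le] applies, and less than [e],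
   so that its bound exceeds [1 - e]. *)
have e10 : 0 < Num.min 1 e / a 0 by rewrite divr_gt0// lt_min e0 ltr01.
move=> /cvgrPdistC_lt /(_ _ e0)[N1 _ /= N1e].
have [N2 _ /= N2e] := cvgr_lt _ r_cvg0 _ e10.
exists (maxn N1 N2) => n t; rewrite geq_max => /andP[/N1e fg /N2e].
rewrite ltr_pdivlMr// mulrC lt_min => /andP[ar1 are] tt.
have t_gt0 := lt_le_trans t00 tt; have gt := limit_gt0 t_gt0.
have := limit_le t_gt0 (ltW ar1); rewrite -ler_pdivlMr// => fg_ge.
have : f n t / g t <= f n t0 / g t0.
  rewrite -(invf_div (g t)) -(invf_div (g t0)).
  rewrite lef_pV2 ?posrE ?divr_gt0 ?density_gt0//.
  exact: limit_quotient_nondecreasing.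
by move: fg; rewrite !ltr_norml => /andP[_ fg] fg_le; apply/andP; split; lra.
Qed.

Hypothesis fSE : forall n t, 0 < t -> f n.+1 t = a n.+1 * (H n t - H n.+1 t).

(** [H n t - G t] telescopes into the sum of [f k t / a k] over [k > n], and for large [n] every
    [f k t] in it is within [e * g t] of [g t]. *)
Lemma tail_equivalent t : 0 < t ->
  (fun n => (H n t - G t) / (g t * r n)) @ \oo --> (1 : R).
Proof.
move=> t0; have g0 := limit_gt0 t0.
apply/cvgrPdistC_le => e e0.
have [N Ne] := density_cvg_uniform t0 e0.
exists N => //= n /= Nn.
have gr0 : 0 < g t * r n by rewrite mulr_gt0.
have -> : (H n t - G t) / (g t * r n) - 1 =
    (H n t - G t - g t * r n) / (g t * r n) by field; rewrite !gt_eqF.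
rewrite normrM normfV (gtr0_norm gr0) ler_pdivrMr// mulrA.
(* The comparison is made for sums stopped at [m]; then [m] tends to infinity. *)
apply: (@ler_cvg_to _ \oo _ _ (fun m =>
   `|H n t - H m t - g t * \sum_(n.+1 <= k < m.+1) (a k)^-1|)
   (fun m => e * g t * \sum_(n.+1 <= k < m.+1) (a k)^-1)).
- apply: cvg_norm; apply: cvgB; last by apply: cvgM; [exact: cvg_cst|exact: (@r_cvg)].
  by apply: cvgB; [exact: cvg_cst|exact: H_cvg].
- by apply: cvgM; [exact: cvg_cst|exact: (@r_cvg)].
exists n => //= m /= nm.
have -> : H n t - H m t = \sum_(n.+1 <= k < m.+1) f k t / a k.
  rewrite -(subnKC nm); elim: (m - n)%N => [|k IHk].
    by rewrite addn0 big_geq// subrr.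
  rewrite addnS big_nat_recr/= ?ltnS ?leq_addr// -IHk fSE//.
  by rewrite mulrAC mulfV ?gt_eqF//; ring.
rewrite !mulr_sumr -sumrB; apply: le_trans (ler_norm_sum _ _ _) _.
rewrite !big_nat; apply: ler_sum => k /andP[nk km].
rewrite -mulrBl normrM normfV (gtr0_norm (a_gt0 k)) ler_pM2r ?invr_gt0//.
have -> : f k t - g t = (f k t / g t - 1) * g t by field; rewrite gt_eqF.
rewrite normrM (gtr0_norm g0) ler_pM2r// ltW// Ne//.
exact: leq_trans Nn (ltnW nk).
Qed.

End limit.
End convolution_densities.

(** * Distribution function of the sum with an independent exponential variable *)

(** The integral of [c * expR (- (c * (t - u))) * K u] over [0, t]: the effect on a distribution
    function [K] of adding an independent exponential variable of rate [c]. The factor in [t] stands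
    outside, so that [t] enters the integral only as its upper limit. *)
Definition exp_convolution {R : realType} (c : R) (K : R -> R) (t : R) : R :=
  c * expR (- (c * t)) *
  (\int[lebesgue_measure]_(u in `[0, t]) (expR (c * u) * K u))%R.

Section exp_convolution.
Context {R : realType} (c : R) (K : R -> R).
Hypothesis K_cont : continuous K.
Local Notation mu := (@lebesgue_measure R).

Let h u := expR (c * u) * K u.

Let h_cont : continuous h.
Proof. by move=> u; apply: cvgM; [exact: continuous_expRM|exact: K_cont]. Qed.

Let h_int b : mu.-integrable `[0, b] (EFin \o h).
Proof.
apply: continuous_compact_integrable; first exact: segment_compact.
exact: continuous_subspaceT.
Qed.

Lemma exp_convolution_le0 t : t <= 0 -> exp_convolution c K t = 0.
Proof.
rewrite le_eqVlt /exp_convolution => /predU1P[->|t0].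
  by rewrite set_itv1 Rintegral_set1 mulr0.
by rewrite set_itv_ge ?Rintegral_set0 ?mulr0// bnd_simp -ltNge.
Qed.

Lemma exp_convolution_derive (t : R) : 0 < t ->
  is_derive t 1 (exp_convolution c K) (c * (K t - exp_convolution c K t)).
Proof.
move=> t0.
have t1 : t < t + 1 by rewrite ltrDl.
have [dI I'] := continuous_FTC1_closed t1 (h_int (t + 1)) t0 (@h_cont t).
have dIs : is_derive t 1 (fun x => (\int[mu]_(u in `[0, x]) h u)%R) (h t).
  by apply: DeriveDef; [exact: dI|rewrite -derive1E].
rewrite /exp_convolution; apply: is_derive_eq.
rewrite /GRing.scale/= /h.
move: (Rintegral _ _ _) => I.
have e1 := expRxMexpNx_1 (c * t).
move: (expR (c * t)) (expR (- (c * t))) e1 => x y xy.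
have -> : c * (K t - c * y * I) = c * (x * y * K t - c * y * I).
  by rewrite xy mul1r.
ring.
Qed.

Lemma continuous_exp_convolution : continuous (exp_convolution c K).
Proof.
move=> t; have [t0|t0|->] := ltgtP t 0.
- rewrite /continuous_at (exp_convolution_le0 (ltW t0)).
  apply: cvg_near_cst; near=> x; apply: exp_convolution_le0; apply: ltW.
  by near: x; exact: (lt_nbhsl t0).
- have dE := exp_convolution_derive t0.
  exact/differentiable_continuous/derivable1_diffP.
(* There may be a corner at 0, so continuity comes from that of the integral in its upper limit. *)
- rewrite /continuous_at exp_convolution_le0//.
  suff : exp_convolution c K x @[x --> (0 : R)] --> c * expR (- (c * 0)) * 0.
    by rewrite [_ * _ * 0]mulr0.
  apply: cvgM; last exact: (parameterized_integral_cvg_left ltr01 (h_int 1)).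
  apply: cvgM; first exact: cvg_cst.
  under eq_fun do rewrite -mulNr.
  by rewrite -mulNr; exact: continuous_expRM.
Unshelve. all: by end_near. Qed.

End exp_convolution.

Section convolution_cdf.
Context {R : realType}.
Local Notation mu := (@lebesgue_measure R).

(** By the substitution [u = t - y], which reverses orientation. *)
Lemma integral_exponential_pdf_convolution (c : R) (K : R -> R) (t : R) :
  continuous K -> 0 <= t ->
  (\int[mu]_(y in `[0%R, t]) (exponential_pdf c y * K (t - y))%:E =
   (exp_convolution c K t)%:E)%E.
Proof.
move=> K_cont t0.
pose G (u : R) := c * expR (- (c * t)) * (expR (c * u) * K u).
have G_cont : continuous G.
  move=> u; apply: cvgM; first exact: cvg_cst.
  by apply: cvgM; [exact: continuous_expRM|exact: K_cont].
pose S := (fun y : R => t - y).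
have dSy (y : R) : is_derive y 1 S (-1).
  by rewrite /S; apply: is_derive_eq; ring.
have dS : derive1 S = cst (-1).
  by apply/funext => y; rewrite derive1E (@derive_val _ _ _ _ _ _ _ (dSy y)).
have S_cont : continuous S.
  by move=> y; apply: cvgB; [exact: cvg_cst|exact: cvg_id].
transitivity (\int[mu]_(y in `[0%R, t]) (G y)%:E)%E.
  have := @integration_by_substitution_decreasing R S G 0 t t0.
  have -> : S 0 = t by rewrite /S subr0.
  have -> : S t = 0 by rewrite /S subrr.
  rewrite dS => ->.
  - apply: eq_integral => y; rewrite inE/= in_itv/= => /andP[y0 yt].
    rewrite exponential_pdfE// /G /S !fctE/= opprK mulr1; congr EFin.
    have -> : expR (- c * y) = expR (- (c * t)) * expR (c * (t - y)).
      by rewrite -expRD; congr expR; ring.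
    by ring.
  - by move=> x y _ _ xy; rewrite /S ltrD2l ltrN2.
  - by move=> y _; exact: cvg_cst.
  - exact: is_cvg_cst.
  - exact: is_cvg_cst.
  - split.
    + by move=> y _; exact: (@ex_derive _ _ _ _ _ _ _ (dSy y)).
    + by apply: cvg_at_right_filter; exact: S_cont.
    + by apply: cvg_at_left_filter; exact: S_cont.
  - exact: continuous_subspaceT.
pose h (u : R) := expR (c * u) * K u.
have h_int : mu.-integrable `[0, t] (EFin \o h).
  apply: continuous_compact_integrable; first exact: segment_compact.
  by apply: continuous_subspaceT => u; apply: cvgM; [exact: continuous_expRM|exact: K_cont].
rewrite /exp_convolution EFinM /Rintegral fineK; last first.
  exact: integrable_fin_num.
by rewrite -integralZl.
Qed.

Context d (Omega : measurableType d) (P : probability Omega R).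

(** Independence makes the joint law a product, and Tonelli's theorem on the half-plane [x + y <= t]
    lets the integral over [x] be taken first. [K] is cut off below 0 so that the constant 0, whose
    distribution function jumps there, is covered by the continuous [K = 1]. *)
Lemma cdf_add_exponential (X Y : {mfun Omega >-> R}) (c : R) (K : R -> R) (t : R) :
  0 < c -> continuous K ->
  (forall A B, measurable A -> measurable B ->
    P (X @^-1` A `&` Y @^-1` B) = P (X @^-1` A) * P (Y @^-1` B))%E ->
  (forall A, measurable A -> distribution P Y A = exponential_prob c A) ->
  (forall s, P [set w | X w <= s] = (if 0 <= s then K s else 0)%:E) ->
  P [set w | X w + Y w <= t] = (exp_convolution c K t)%:E.
Proof.
move=> c0 K_cont XY Y_exp X_cdf.
have mXY : measurable_fun setT (fun w => (X w, Y w)).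
  exact: measurable_fun_pair.
pose XYf : {mfun Omega >-> (R * R)%type} :=
  HB.pack (fun w => (X w, Y w)) (isMeasurableFun.Build _ _ _ _ _ mXY).
pose D : set (R * R) := [set p | p.1 + p.2 <= t].
have mD : measurable D.
  rewrite -[D]setTI; apply: measurable_fun_le => //.
  by apply: measurable_funD; [exact: measurable_fst|exact: measurable_snd].
have -> : P [set w | X w + Y w <= t] = distribution P XYf D by [].
rewrite -(@product_measure_unique _ _ _ _ R (distribution P X) (distribution P Y)
  (distribution P XYf) _ D mD); last by move=> A B mA mB; rewrite /= -XY.
pose f (p : R * R) := (exponential_pdf c p.2 * \1_D p)%:E.
have mf : measurable_fun setT f.
  apply/measurable_EFinP/measurable_funM.
    by apply: measurableT_comp; [exact: measurable_exponential_pdf|exact: measurable_snd].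
  exact: measurable_indic.
have f0 p : (0 <= f p)%E.
  by rewrite lee_fin mulr_ge0// exponential_pdf_ge0// ltW.
transitivity (\int[distribution P X]_x \int[mu]_y f (x, y))%E.
  apply: eq_integral => x _ /=.
  transitivity (exponential_prob c (xsection D x)).
    by rewrite -Y_exp//; exact: measurable_xsection.
  rewrite /exponential_prob integral_mkcond; apply: eq_integral => y _.
  by rewrite patchE mem_xsection /f indicE; case: ifPn; rewrite ?mulr1 ?mulr0.
rewrite (@fubini_tonelli _ _ _ _ _ (distribution P X) mu f)//.
transitivity (\int[mu]_y (exponential_pdf c y * (if (0 <= t - y)%R then K (t - y) else 0))%:E)%E.
  apply: eq_integral => y _.
  transitivity ((exponential_pdf c y)%:E *
      \int[distribution P X]_x (\1_(ysection D y) x)%:E)%E.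
    rewrite -ge0_integralZl//.
    - apply: eq_integral => x _; rewrite /f EFinM.
      by rewrite !indicE mem_ysection.
    - by apply/measurable_EFinP/measurable_indic; exact: measurable_ysection.
    - by rewrite lee_fin exponential_pdf_ge0// ltW.
  rewrite integral_indic//; last exact: measurable_ysection.
  rewrite setIT EFinM -X_cdf; congr (_ * _)%E.
  rewrite /distribution /pushforward; congr (P _).
  by apply/seteqP; split => w /=; rewrite /ysection/= inE /D/= lerBrDr.
have [t0|t0] := leP 0 t.
  rewrite -integral_exponential_pdf_convolution// [RHS]integral_mkcond.
  apply: eq_integral => y _; rewrite patchE mem_setE in_itv/= subr_ge0.
  have [y0|y0] := leP 0 y; first by case: ifPn; rewrite ?mulr0.
  by rewrite lt0_exponential_pdf ?mul0r.
rewrite exp_convolution_le0 ?ltW// integral0_eq// => y _.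
have [y0|y0] := leP 0 y; last by rewrite lt0_exponential_pdf ?mul0r.
by rewrite ifF ?mulr0//; apply/negbTE; rewrite -ltNge subr_lt0 (lt_le_trans t0).
Qed.

End convolution_cdf.

(** * Independence of partial sums *)

Section independence.
Context {R : realType} d (Omega : measurableType d) (P : probability Omega R).

(** The law of [(X, Y)] restricted to [E] and [P E] times the law of [(X, Y)] are finite measures on
    the plane. They agree on rectangles, a generating family stable under intersection, hence
    everywhere. *)
Lemma independent_add (X Y : {mfun Omega >-> R}) (E : set Omega) (A0 : set R) :
  measurable E -> measurable A0 ->
  (forall A B, measurable A -> measurable B ->
    P (X @^-1` A `&` (Y @^-1` B `&` E)) = P (X @^-1` A `&` Y @^-1` B) * P E)%E ->
  P ([set w | A0 (X w + Y w)%R] `&` E) = (P [set w | A0 (X w + Y w)%R] * P E)%E.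
Proof.
move=> mE mA0 XYE.
have mXY : measurable_fun setT (fun w => (X w, Y w)).
  exact: measurable_fun_pair.
pose XYf : {mfun Omega >-> (R * R)%type} :=
  HB.pack (fun w => (X w, Y w)) (isMeasurableFun.Build _ _ _ _ _ mXY).
pose D : set (R * R) := [set p | A0 (p.1 + p.2)].
have mD : measurable D.
  have mplus : measurable_fun setT (fun p : R * R => p.1 + p.2).
    by apply: measurable_funD; [exact: measurable_fst|exact: measurable_snd].
  by rewrite -[D]setTI; exact: mplus.
have PE0 : 0 <= fine (P E) by exact: fine_ge0.
have PEE : P E = (fine (P E))%:E by rewrite fineK// fin_num_measure.
pose C1 : set (set (R * R)) :=
  [set A `*` B | A in measurable & B in measurable].
pose m1 := pushforward (mrestr P mE) XYf.
pose m2 := mscale (NngNum PE0) (distribution P XYf).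
suff : m1 D = m2 D.
  by rewrite /m1 /m2 /mscale/= -PEE muleC.
apply: (measure_unique C1 (fun=> setT)) => //.
- exact: measurable_prod_measurableType.
- move=> _ _ [A1 mA1 [B1 mB1 <-]] [A2 mA2 [B2 mB2 <-]].
  exists (A1 `&` A2); first exact: measurableI.
  by exists (B1 `&` B2); [exact: measurableI|rewrite setXI].
- by move=> _; exists setT => //; exists setT => //; rewrite setXTT.
- by rewrite bigcup_const.
- move=> _ [A mA [B mB <-]].
  change (P (X @^-1` A `&` Y @^-1` B `&` E) =
    (fine (P E))%:E * P (X @^-1` A `&` Y @^-1` B))%E.
  by rewrite -PEE muleC -setIA XYE.
- move=> _; change (P (XYf @^-1` setT `&` E) < +oo)%E.
  by rewrite ltey_eq fin_num_measure// preimage_setT setTI.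
Qed.

Context (Xi0 : nat) (tau : nat -> {RV P >-> R}).
Hypothesis tau_indep : mutually_independent_from P Xi0 (fun k => tau k : Omega -> R).

(** Indexed by the number of terms, whereas [birth_S] includes its last index: [birth_S] at
    [Xi0 + n] is [partial_sum n.+1]. *)
Definition partial_sum n w : R := \sum_(Xi0 <= l < Xi0 + n) tau l w.

Lemma measurable_partial_sum n : measurable_fun setT (partial_sum n).
Proof. by apply: measurable_sum => l. Qed.

HB.instance Definition _ n :=
  isMeasurableFun.Build _ _ _ _ (partial_sum n) (measurable_partial_sum n).

Lemma partial_sumS n w : partial_sum n.+1 w = partial_sum n w + tau (Xi0 + n) w.
Proof. by rewrite /partial_sum addnS big_nat_recr//= leq_addr. Qed.

Let set_consU (i : nat) (I : seq nat) : [set` i :: I] = i |` [set` I].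
Proof.
apply/seteqP; split => k /=; rewrite in_cons.
  by case/orP => [/eqP->|kI]; [left|right].
by case=> [->|->]; rewrite ?eqxx// orbT.
Qed.

Let cyl (I : seq nat) (B : nat -> set R) := \bigcap_(i in [set` I]) (tau i @^-1` B i).

Let measurable_cyl I B : (forall i, i \in I -> measurable (B i)) -> measurable (cyl I B).
Proof.
move=> mB; apply: fin_bigcap_measurable => // i /= iI.
by rewrite -[_ @^-1` _]setTI; apply: measurable_funP => //; exact: mB.
Qed.

(** Cylinders over arbitrary finite lists of later indices make the induction work: the next holding
    time leaves the sum, by [independent_add], and joins the cylinder. *)
Lemma partial_sum_cylinder_indep n I B A : measurable A -> uniq I ->
  all (fun i => (Xi0 + n <= i)%N) I -> (forall i, i \in I -> measurable (B i)) ->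
  P (partial_sum n @^-1` A `&` \bigcap_(i in [set` I]) (tau i @^-1` B i)) =
  (P (partial_sum n @^-1` A) * P (\bigcap_(i in [set` I]) (tau i @^-1` B i)))%E.
Proof.
rewrite -/(cyl I B).
elim: n I B A => [|n IHn] I B A mA uI ngeI mB.
  have -> : partial_sum 0 = cst 0.
    by apply/funext => w; rewrite /partial_sum addn0 big_geq.
  rewrite preimage_cst; case: ifPn => _.
    by rewrite setTI probability_setT mul1e.
  by rewrite set0I measure0 mul0e.
have -> : partial_sum n.+1 @^-1` A = [set w | A (partial_sum n w + tau (Xi0 + n) w)].
  by apply/funext => w; rewrite /preimage/= partial_sumS.
apply: independent_add => //; first exact: measurable_cyl.
move=> A1 A2 mA1 mA2.
have XinI : (Xi0 + n)%N \notin I.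
  by apply/negP => /(allP ngeI); rewrite addnS ltnn.
(* The condition [A2] on the next holding time is merged into the cylinder as one more
   coordinate. *)
pose B' i := if i == (Xi0 + n)%N then A2 else B i.
have B'X : B' (Xi0 + n)%N = A2 by rewrite /B' eqxx.
have cylB' : tau (Xi0 + n) @^-1` A2 `&` cyl I B = cyl ((Xi0 + n)%N :: I) B'.
  rewrite /cyl set_consU bigcap_setU1 B'X; congr (_ `&` _).
  apply: eq_bigcapr => i /= iI; rewrite /B'; case: eqP => // iX.
  by move: XinI; rewrite -iX iI.
have mB' i : i \in (Xi0 + n)%N :: I -> measurable (B' i).
  by rewrite in_cons /B'; case: eqP => //= _; exact: mB.
have ngeI' : all (fun i => (Xi0 + n <= i)%N) ((Xi0 + n)%N :: I).
  rewrite /= leqnn/=; apply/allP => i /(allP ngeI); rewrite addnS; exact: ltnW.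
have Xi0I (J : seq nat) : all (fun i => (Xi0 + n <= i)%N) J ->
    all (fun i => (Xi0 <= i)%N) J.
  by apply: sub_all => i; apply: leq_trans; exact: leq_addr.
rewrite cylB' IHn//; last by rewrite /= XinI.
have -> : P (cyl ((Xi0 + n)%N :: I) B') = (P (tau (Xi0 + n) @^-1` A2) * P (cyl I B))%E.
  rewrite /cyl !tau_indep//.
  - rewrite big_cons B'X; congr (_ * _)%E.
    apply: eq_big_seq => i iI; rewrite /B'; case: eqP => // iX.
    by move: XinI; rewrite -iX iI.
  - by apply: Xi0I; move: ngeI' => /= /andP[].
  - by rewrite /= XinI.
  - exact: Xi0I.
(* The one-index case reassembles the joint probability of the sum and the next holding time. *)
have := IHn [:: (Xi0 + n)%N] (fun=> A2) A1 mA1.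
rewrite /cyl set_cons1 bigcap_set1 => -> //; first by rewrite muleA.
by rewrite /= leqnn.
Qed.

Lemma partial_sum_indep n A B : measurable A -> measurable B ->
  (P (partial_sum n @^-1` A `&` tau (Xi0 + n) @^-1` B) =
   P (partial_sum n @^-1` A) * P (tau (Xi0 + n) @^-1` B))%E.
Proof.
move=> mA mB.
have := @partial_sum_cylinder_indep n [:: (Xi0 + n)%N] (fun=> B) A mA.
rewrite set_cons1 bigcap_set1; apply => //.
by rewrite /= leqnn.
Qed.

End independence.

(** * Events of the birth process *)

(* Where the sequence diverges, [limn] takes the default value [point]. *)
Lemma measurable_limn_le d (Omega : measurableType d) (R : realType)
    (u : nat -> Omega -> \bar R) (s : \bar R) :
  (forall n, measurable_fun setT (u n)) ->
  measurable [set w | limn (u ^~ w) <= s]%E.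
Proof.
move=> mu_.
pose sup w := limn_esup (u ^~ w); pose inf w := limn_einf (u ^~ w).
have msup : measurable_fun setT sup by exact: measurable_fun_limn_esup.
have minf : measurable_fun setT inf.
  apply: measurableT_comp => //.
  by apply: measurable_fun_limn_esup => n; exact: measurableT_comp.
(* Convergence becomes equality of lower and upper limits, which is a measurable condition. *)
have cvgE w : cvgn (u ^~ w) <-> inf w = sup w.
  split=> [uw|infsup].
    by rewrite /inf /sup is_cvg_limn_einfE// is_cvg_limn_esupE.
  apply/cvg_ex; exists (sup w).
  apply: (@squeeze_cvge _ _ _ _ (einfs (u ^~ w)) _ (esups (u ^~ w))).
  - near=> n; apply/andP; split.
      by apply: ereal_inf_lbound; exists n => //=.
    by apply: ereal_sup_ubound; exists n => //=.
  - by rewrite -infsup /inf limn_einf_lim; exact: is_cvg_einfs.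
  - by rewrite /sup limn_esup_lim; exact: is_cvg_esups.
have -> : [set w | limn (u ^~ w) <= s]%E =
    ([set w | inf w = sup w] `&` [set w | sup w <= s]%E) `|`
    (~` [set w | inf w = sup w] `&` [set w | (point : \bar R) <= s]%E).
  apply/seteqP; split => w /=.
    have [/[dup] uw /cvgE infsup|uw] := pselect (cvgn (u ^~ w)).
      by left; split => //; rewrite /sup is_cvg_limn_esupE.
    by rewrite dvgP// => ps; right; split => // /cvgE.
  case=> [[/cvgE uw]|[infsup]]; first by rewrite /sup is_cvg_limn_esupE.
  by rewrite dvgP// => /cvgE.
have mC : measurable [set w | inf w = sup w].
  by rewrite -[X in measurable X]setTI; exact: measurable_eqe.
apply: measurableU; apply: measurableI => //.
- by rewrite -[X in measurable X]setTI; apply: measurable_lee => //; exact: measurable_cst.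
- exact: measurableC.
- rewrite -[X in measurable X]setTI.
  by apply: (@measurable_lee _ _ _ _ measurableT (cst point) (cst s)) => //;
    exact: measurable_cst.
Unshelve. all: by end_near. Qed.

(** On [0, +oo[, the distribution function of a sum of [n] independent exponential variables with
    rates [a 0], ..., [a n.-1]. For [n = 0] the value 1 is kept at negative times, for
    continuity. *)
Fixpoint hypoexponential_cdf {R : realType} (a : nat -> R) (n : nat) (t : R) : R :=
  if n is m.+1 then exp_convolution (a m) (hypoexponential_cdf a m) t else 1.

Lemma continuous_hypoexponential_cdf {R : realType} (a : nat -> R) n :
  continuous (hypoexponential_cdf a n).
Proof.
elim: n => [|n IHn]; first by move=> t; exact: cvg_cst.
exact: continuous_exp_convolution.
Qed.

Section birth_events.
Context {R : realType} d (Omega : measurableType d) (P : probability Omega R).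
Context (F : nat -> R) (Xi0 : nat) (tau : nat -> {RV P >-> R}).
Hypothesis F_gt0 : forall k, (1 <= k)%N -> 0 < F k.
Hypothesis Xi0_gt0 : (1 <= Xi0)%N.
Hypothesis tau_exp : forall k, (Xi0 <= k)%N -> forall A, measurable A ->
  distribution P (tau k) A = exponential_prob (F k) A.
Hypothesis tau_indep :
  mutually_independent_from P Xi0 (fun k => tau k : Omega -> R).

Let a n := F (Xi0 + n).

Let a_gt0 n : 0 < a n.
Proof. by apply: F_gt0; rewrite addn_gt0 Xi0_gt0. Qed.

Local Notation X := (partial_sum Xi0 tau).
Local Notation H := (hypoexponential_cdf a).

Lemma partial_sum_cdf n s :
  P [set w | X n w <= s] = (if 0 <= s then H n s else 0)%:E.
Proof.
elim: n s => [|n IHn] s.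
  have -> : X 0 = cst 0 by apply/funext => w; rewrite /partial_sum addn0 big_geq.
  have [s0|s0] := leP 0 s.
    by rewrite -[RHS](probability_setT P); congr (P _); apply/seteqP; split.
  by rewrite -[RHS](measure0 P); congr (P _); apply/seteqP; split => w //=; rewrite leNgt s0.
transitivity (P [set w | X n w + tau (Xi0 + n)%N w <= s]).
  by congr (P _); apply/funext => w /=; rewrite partial_sumS.
rewrite (@cdf_add_exponential _ _ _ P (X n) (tau (Xi0 + n)%N) (a n) (H n))//.
- by have [//|s0] := leP 0 s; rewrite exp_convolution_le0// ltW.
- exact: continuous_hypoexponential_cdf.
- by move=> A B mA mB; exact: partial_sum_indep.
- by move=> A mA; rewrite tau_exp// leq_addr.
Qed.

(** An almost sure event on which the partial sums are nondecreasing; events are identified pathwise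
    on it. *)
Let Pos : set Omega := [set w | forall k, (Xi0 <= k)%N -> 0 <= tau k w].

Let PosE : Pos = ~` \bigcup_k (tau (Xi0 + k)%N @^-1` `]-oo, 0[).
Proof.
apply/seteqP; split => w.
  by move=> pos_w [k _ /=]; rewrite in_itv/= ltNge pos_w// leq_addr.
move=> npos k Xi0k; rewrite leNgt; apply/negP => tau0; apply: npos.
by exists (k - Xi0)%N => //=; rewrite in_itv/= subnKC.
Qed.

Let mtau k (A : set R) : measurable A -> measurable (tau k @^-1` A).
Proof. by move=> mA; rewrite -[_ @^-1` _]setTI; exact: measurable_funP. Qed.

Let measurable_Pos : measurable Pos.
Proof.
by rewrite PosE; apply: measurableC; apply: bigcupT_measurable => k; exact: mtau.
Qed.

Let P_Pos : P (~` Pos) = 0%E.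
Proof.
apply/negligibleP; first exact: measurableC.
rewrite PosE setCK; apply: negligible_bigcup => k.
apply/negligibleP; first exact: mtau.
have := tau_exp (leq_addr k Xi0) (measurable_itv `]-oo, (0 : R)[).
rewrite /distribution /pushforward => PE; apply: (eq_trans PE).
apply: integral0_eq => y /=; rewrite in_itv/= => y0.
by rewrite lt0_exponential_pdf.
Qed.

Let eq_measure_Pos A B : measurable A -> measurable B ->
  A `&` Pos = B `&` Pos -> P A = P B.
Proof.
move=> mA mB AB.
have PI C : measurable C -> P C = P (C `&` Pos).
  move=> mC; rewrite (measureDI P mC measurable_Pos) setDE.
  rewrite (@subset_measure0 _ _ _ _ _ (~` Pos)) ?add0e//.
  - by apply: measurableI => //; exact: measurableC.
  - exact: measurableC.
by rewrite PI// AB -PI.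
Qed.

Let measureD_Pos A B : measurable A -> measurable B -> B `&` Pos `<=` A ->
  P (A `\` B) = (P A - P B)%E.
Proof.
move=> mA mB BA; rewrite measureD//; last by rewrite ltey_eq fin_num_measure.
congr (_ - _)%E; apply: eq_measure_Pos => //; first exact: measurableI.
apply/seteqP; split => w /=; first by case=> [[]].
by move=> [Bw pos_w]; split => //; split => //; exact: BA.
Qed.

Lemma birth_S_partial_sum n w : birth_S Xi0 (fun k => tau k) (Xi0 + n) w = X n.+1 w.
Proof. by rewrite /birth_S /partial_sum addnS. Qed.

Let X_nondecreasing w n m : Pos w -> (n <= m)%N -> X n w <= X m w.
Proof.
move=> pos_w nm; rewrite -(subnKC nm); elim: (m - n)%N => [|k IHk].
  by rewrite addn0.
by rewrite addnS partial_sumS (le_trans IHk)// lerDl pos_w// leq_addr.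
Qed.

(** Since the partial sums are nondecreasing on [Pos], minimality only has to be tested at the
    preceding index. *)
Let birth_Xi_isE t n w : 0 < t -> Pos w ->
  birth_Xi_is Xi0 (fun k => tau k) t (Xi0 + n) w <-> X n w <= t < X n.+1 w.
Proof.
move=> t0 pos_w; rewrite /birth_Xi_is birth_S_partial_sum; split.
  move=> [_ tX Xt]; rewrite tX andbT leNgt; apply/negP.
  case: n tX Xt => [_ _|n _ /(_ (Xi0 + n)%N)].
    by rewrite /partial_sum addn0 big_geq// ltNge ltW.
  by rewrite birth_S_partial_sum addn_gt0 Xi0_gt0 addnS ltnSn; exact.
move=> /andP[Xt tX]; split => //; first by rewrite addn_gt0 Xi0_gt0.
(* For [k < Xi0] the sum [birth_S] is empty, and 0 does not exceed [t]. *)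
move=> k /andP[k1 kx]; have [Xi0k|kXi0] := leqP Xi0 k; last first.
  by rewrite /birth_S big_geq// ltNge ltW.
rewrite -(subnKC Xi0k) birth_S_partial_sum; apply/negP; rewrite -leNgt.
apply: le_trans Xt; apply: X_nondecreasing => //.
by rewrite -(ltn_add2l Xi0) subnKC.
Qed.

Let mX n t : measurable [set w | X n w <= t].
Proof.
by rewrite -[X in measurable X]setTI; apply: measurable_fun_le.
Qed.

Lemma measurable_birth_Xi_is t x :
  measurable [set w | birth_Xi_is Xi0 (fun k => tau k) t x w].
Proof.
have mS k : measurable [set w | t < birth_S Xi0 (fun k => tau k) k w].
  have -> : [set w | t < birth_S Xi0 (fun k => tau k) k w] =
      ~` [set w | birth_S Xi0 (fun k => tau k) k w <= t].
    by apply/seteqP; split => w /=; rewrite ltNge => /negP.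
  apply: measurableC; rewrite -[X in measurable X]setTI; apply: measurable_fun_le => //.
  by apply: measurable_sum => l.
have [x1|] := boolP (1 <= x)%N; last first.
  move=> x0; rewrite [X in measurable X](_ : _ = set0)//.
  by apply/seteqP; split => // w [] x1; rewrite x1 in x0.
rewrite [X in measurable X](_ : _ = [set w | t < birth_S Xi0 (fun k => tau k) x w] `&`
    \bigcap_(k in [set k | (1 <= k < x)%N]) ~` [set w | t < birth_S Xi0 (fun k => tau k) k w]).
  by apply: measurableI => //; apply: bigcap_measurableType => k _; exact: measurableC.
by apply/seteqP; split => w [].
Qed.

Lemma birth_Xi_is_prob t n : 0 < t ->
  P [set w | birth_Xi_is Xi0 (fun k => tau k) t (Xi0 + n) w] = (H n t - H n.+1 t)%:E.
Proof.
move=> t0.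
rewrite (@eq_measure_Pos _ ([set w | X n w <= t] `\` [set w | X n.+1 w <= t])).
- rewrite measureD_Pos//; first by rewrite !partial_sum_cdf ltW.
  by move=> w [/= Xt pos_w]; apply: le_trans Xt; exact: X_nondecreasing.
- exact: measurable_birth_Xi_is.
- exact: measurableD.
- apply/seteqP; split => w /= [].
    move=> /[swap] pos_w /(birth_Xi_isE _ t0 pos_w)/andP[Xt tX]; split => //.
    by split => //; apply/negP; rewrite -ltNge.
  move=> [Xt /negP]; rewrite -ltNge => tX pos_w; split => //.
  by apply/(birth_Xi_isE _ t0 pos_w); rewrite Xt.
Qed.

Local Notation T := (birth_T Xi0 (fun k => tau k)).

Lemma measurable_birth_T_le (s : \bar R) : measurable [set w | T w <= s]%E.
Proof.
apply: measurable_limn_le => n.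
by apply: emeasurable_sum => k; exact/measurable_EFinP.
Qed.

(** On [Pos] the series has nonnegative terms, so its sum is the supremum of its partial sums. *)
Let birth_T_leE s w : Pos w -> (T w <= s%:E)%E <-> forall n, X n w <= s.
Proof.
move=> pos_w.
have XE n : (\sum_(Xi0 <= k < Xi0 + n) (tau k w)%:E)%E = (X n w)%:E.
  by rewrite sumEFin.
have tau0 k : (Xi0 <= k)%N -> true -> (0 <= (tau k w)%:E)%E.
  by move=> Xi0k _; rewrite lee_fin pos_w.
split=> [Ts n|Xs].
  rewrite -lee_fin -XE; apply: le_trans Ts; exact: nneseries_lim_ge.
apply: lime_le; first exact: is_cvg_nneseries.
exists Xi0 => // n /= Xi0n.
by rewrite -(subnKC Xi0n) XE lee_fin.
Qed.

(** Continuity of [P] from above along the events [X n <= t], intersected with [Pos] to make them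
    decreasing. *)
Lemma partial_sum_cdf_cvg t : 0 < t ->
  H n t @[n --> \oo] --> fine (P [set w | T w <= t%:E]%E).
Proof.
move=> t0.
pose A n := [set w | X n w <= t] `&` Pos.
have mA n : measurable (A n) by exact: measurableI.
have PA n : P (A n) = (H n t)%:E.
  rewrite (@eq_measure_Pos _ [set w | X n w <= t])//.
    by rewrite partial_sum_cdf ltW.
  by rewrite -setIA setIid.
have AE : P (\bigcap_n A n) = P [set w | T w <= t%:E]%E.
  apply: eq_measure_Pos.
  - exact: bigcap_measurableType.
  - exact: measurable_birth_T_le.
  - apply/seteqP; split => w /= [].
      move=> wA pos_w; split => //; apply/birth_T_leE => // n.
      by have [] := wA n I.
    move=> /[swap] pos_w /(birth_T_leE _ pos_w) wA; split => // n _.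
    by split => //; exact: wA.
have : P \o A @ \oo --> P (\bigcap_n A n).
  apply: nonincreasing_cvg_mu => //.
  - by rewrite ltey_eq fin_num_measure.
  - exact: bigcap_measurableType.
  - move=> n m nm; apply/subsetPset => w [/= Xt pos_w]; split => //=.
    by apply: le_trans Xt; exact: X_nondecreasing.
have PT : P [set w | T w <= t%:E]%E \is a fin_num.
  by rewrite fin_num_measure//; exact: measurable_birth_T_le.
rewrite AE -(fineK PT) => /fine_cvgP[_].
by have -> : fine \o (P \o A) = (fun n => H n t) by apply/funext => n /=; rewrite PA.
Qed.

(** On [Pos], the process is beyond [Xi0 + n] without having exploded exactly when [X n.+1 <= t] and
    not [T <= t]. *)
Lemma birth_Xi_gt_prob t n : 0 < t ->
  fine (P [set w | (t%:E < T w)%E /\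
    exists y, (Xi0 + n < y)%N /\ birth_Xi_is Xi0 (fun k => tau k) t y w]) =
  H n.+1 t - fine (P [set w | T w <= t%:E]%E).
Proof.
move=> t0.
set E := [set w | _].
have mT := measurable_birth_T_le t%:E.
have E_TB : E = ~` [set w | T w <= t%:E]%E `&`
    \bigcup_(y in [set y | (Xi0 + n < y)%N])
      [set w | birth_Xi_is Xi0 (fun k => tau k) t y w].
  apply/seteqP; split => w /=.
    by move=> [tT [y [xy By]]]; split; [apply/negP; rewrite -ltNge|exists y].
  by move=> [/negP]; rewrite -ltNge => tT [y xy By]; split => //; exists y.
have mE : measurable E.
  rewrite E_TB; apply: measurableI; first exact: measurableC.
  by apply: bigcup_measurable => y _; exact: measurable_birth_Xi_is.
rewrite (@eq_measure_Pos _ ([set w | X n.+1 w <= t] `\` [set w | T w <= t%:E]%E))//.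
- rewrite measureD_Pos//.
    by rewrite partial_sum_cdf (ltW t0) fineB// fin_num_measure.
  by move=> w [/= Tt pos_w]; exact: (iffLR (birth_T_leE _ pos_w) Tt).
- exact: measurableD.
apply/seteqP; split => w /= [].
  move=> [tT [y [xy By]]] pos_w; split => //; split; last first.
    by apply/negP; rewrite -ltNge.
  have Xi0y : (Xi0 <= y)%N by rewrite (leq_trans _ (ltnW xy))// leq_addr.
  move: By; rewrite -(subnKC Xi0y) => /(birth_Xi_isE _ t0 pos_w)/andP[Xt _].
  by apply: le_trans Xt; apply: X_nondecreasing => //; rewrite -(ltn_add2l Xi0) subnKC.
move=> [Xt Tt] pos_w; split => //; split.
  by rewrite ltNge; apply/negP.
(* As explosion comes after [t], some partial sum exceeds [t]; the least such index is [k.+1], where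
   [Xi0 + k] is the occupied state. Index 0 is excluded because the empty sum is below [t]. *)
have [m tX] : exists m, t < X m w.
  apply: contrapT => /forallNP Xle; apply: Tt.
  by apply/birth_T_leE => // m; rewrite leNgt; apply/negP.
have exX : exists m, t < X m w by exists m.
case: (ex_minnP exX) => -[|k] tXk min_k.
  by move: tXk; rewrite /partial_sum addn0 big_geq// ltNge ltW.
have Xkt : X k w <= t.
  by rewrite leNgt; apply/negP => /min_k; rewrite ltnn.
exists (Xi0 + k)%N; split; last by apply/(birth_Xi_isE _ t0 pos_w); rewrite Xkt.
rewrite ltn_add2l ltnNge; apply/negP => kn.
by move: tXk; rewrite ltNge (le_trans _ Xt)//; exact: X_nondecreasing.
Qed.

End birth_events.

(** * The asymptotics *)

Section hypoexponential.
Context {R : realType} (a : nat -> R).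
Local Notation H := (hypoexponential_cdf a).

(** The density of the sum of [n.+1] exponential variables, as given by the derivative of [H n.+1].
    For [t <= 0], [f 0] keeps the value [a 0], so that it is continuous at 0. *)
Definition hypoexponential_pdf n t : R := a n * (H n t - H n.+1 t).
Local Notation f := hypoexponential_pdf.

Lemma hypoexponential_cdfS_derive n (t : R) : 0 < t -> is_derive t 1 (H n.+1) (f n t).
Proof. by move=> t0; apply: exp_convolution_derive => //; exact: continuous_hypoexponential_cdf. Qed.

Lemma continuous_hypoexponential_pdf n : continuous (f n).
Proof.
move=> t; apply: cvgM; first exact: cvg_cst.
by apply: cvgB; exact: continuous_hypoexponential_cdf.
Qed.

Lemma hypoexponential_pdf0_at0 : f 0 0 = a 0.
Proof. by rewrite /f /= exp_convolution_le0// subr0 mulr1. Qed.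

Lemma hypoexponential_pdfS_at0 n : f n.+1 0 = 0.
Proof. by rewrite /f /= !exp_convolution_le0// subr0 mulr0. Qed.

Lemma hypoexponential_pdf0_derive (t : R) : 0 < t -> is_derive t 1 (f 0) (- a 0 * f 0 t).
Proof.
move=> t0; have dH := hypoexponential_cdfS_derive 0 t0.
rewrite [X in is_derive _ _ X _](_ : _ = fun t => a 0 * (1 - H 1 t))//.
move: (H 1) (f 0 t) dH => K y dK.
by apply: is_derive_eq; rewrite /GRing.scale/=; ring.
Qed.

Lemma hypoexponential_pdfS_derive n (t : R) : 0 < t ->
  is_derive t 1 (f n.+1) (a n.+1 * (f n t - f n.+1 t)).
Proof.
move=> t0; have dH := hypoexponential_cdfS_derive n t0.
have dHS := hypoexponential_cdfS_derive n.+1 t0.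
rewrite [X in is_derive _ _ X _](_ : _ = fun t => a n.+1 * (H n.+1 t - H n.+2 t))//.
move: (H n.+1) (H n.+2) (f n t) (f n.+1 t) dH dHS => K L y z dK dL.
by apply: is_derive_eq; rewrite /GRing.scale/=; ring.
Qed.

End hypoexponential.

Lemma series_tail_cvg {R : realType} (u : nat -> R) x :
  cvgn (series (fun k => u k.+1)) ->
  (fun n => \sum_(x.+1 <= k < n) u k) @ \oo -->
    limn (series (fun k => u k.+1)) - series (fun k => u k.+1) x.
Proof.
move=> cu; rewrite -cvg_shiftS /=.
apply: (@cvg_trans _ ((fun n => series (fun k => u k.+1) n
    - series (fun k => u k.+1) x) @ \oo)); last first.
  by apply: cvgB; [exact: cu|exact: cvg_cst].
apply: near_eq_cvg; exists x => // n /= xn.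
by rewrite big_add1/= /series/= (big_cat_nat _ (n := x))//= addrAC subrr add0r.
Qed.

(** As [G (t + 1)] is a real number, [g] is integrable up to [t + 1], and the fundamental theorem of
    calculus applies at the continuity point [t]. *)
Lemma Rintegral_density_derive {R : realType} (g G : R -> R) (t : R) :
  measurable_fun setT g -> (forall s, 0 <= g s) -> {for t, continuous g} ->
  (forall s, (G s)%:E = \int[lebesgue_measure]_(y in `]-oo, s]) (g y)%:E)%E ->
  is_derive t 1 G (g t).
Proof.
move=> mg g0 gt GE.
have gint : lebesgue_measure.-integrable `]-oo, t + 1] (EFin \o g).
  apply/integrableP; split; first exact/measurable_EFinP/measurable_funTS.
  under eq_integral do rewrite /= ger0_norm//.
  by rewrite -GE ltry.
have t1 : t < t + 1 by rewrite ltrDl.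
have [] := continuous_FTC1 t1 gint (ltNyr _) gt.
have -> : (fun y => \int[lebesgue_measure]_(s in [set` `]-oo, y]]) g s)%R = G.
  by apply/funext => s; rewrite /Rintegral -GE.
by move=> dG G'; apply: DeriveDef; [exact: dG|rewrite -derive1E].
Qed.

(** A density is determined only almost everywhere; continuity on positive times selects the version
    that the pointwise claims are about. *)
Theorem theorem1 (R : realType) (d : measure_display) (Omega : measurableType d)
  (P : probability Omega R) (F : nat -> R) (Xi0 : nat)
  (tau : nat -> {RV P >-> R}) (g : R -> R) :
  (forall k, (1 <= k)%N -> 0 < F k) ->
  cvgn (series (fun k => (F k.+1)^-1)) ->
  (1 <= Xi0)%N ->
  (forall k, (Xi0 <= k)%N -> forall A, measurable A ->
     distribution P (tau k) A = exponential_prob (F k) A) ->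
  mutually_independent_from P Xi0 (fun k => tau k : Omega -> R) ->
  measurable_fun setT g -> (forall s, 0 <= g s) ->
  (forall s, P [set w | (birth_T Xi0 (fun k => tau k) w <= s%:E)%E] =
             (\int[lebesgue_measure]_(y in `]-oo, s]) (g y)%:E)%E) ->
  (forall s, 0 < s -> {for s, continuous g}) ->
  [/\
   (forall t, 0 < t ->
      (fun x => fine (P [set w | birth_Xi_is Xi0 (fun k => tau k) t x w])
                / (g t / F x)) @ \oo --> (1 : R)),
   (forall t0, 0 < t0 -> forall e, 0 < e -> exists N : nat,
      forall (x : nat) (t : R), (N <= x)%N -> t0 < t ->
      `| fine (P [set w | birth_Xi_is Xi0 (fun k => tau k) t x w])
           / (g t / F x) - 1 | < e) &
   (forall t, 0 < t ->
      (fun x : nat =>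
         (fine (P [set w | (t%:E < birth_T Xi0 (fun k => tau k) w)%E /\
                           exists y, (x < y)%N /\ birth_Xi_is Xi0 (fun k => tau k) t y w])
          / fine (P [set w | (t%:E < birth_T Xi0 (fun k => tau k) w)%E]))
         / (- derive1 (fun s => ln (fine (P [set w | (s%:E < birth_T Xi0 (fun k => tau k) w)%E]))) t
            * limn (fun n => \sum_(x.+1 <= k < n) (F k)^-1))) @ \oo --> (1 : R))].
Proof.
move=> F_gt0 F_sum Xi0_gt0 tau_exp tau_indep mg g_ge0 T_density g_cont.
pose a n := F (Xi0 + n)%N.
pose H := hypoexponential_cdf a.
pose f := hypoexponential_pdf a.
pose G s := fine (P [set w | (birth_T Xi0 (fun k => tau k) w <= s%:E)%E]).
pose r n := limn (fun m => \sum_((Xi0 + n).+1 <= k < m) (F k)^-1).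
have a_gt0 n : 0 < a n by apply: F_gt0; rewrite addn_gt0 Xi0_gt0.
have f_cont n : continuous (f n) by exact: continuous_hypoexponential_pdf.
have f0_gt0 : 0 < f 0%N 0 by rewrite /f hypoexponential_pdf0_at0.
have fS0 n : f n.+1 0 = 0 by exact: hypoexponential_pdfS_at0.
have f0_derive (t : R) : 0 < t -> is_derive t 1 (f 0%N) (- a 0%N * f 0%N t).
  exact: hypoexponential_pdf0_derive.
have fS_derive n (t : R) : 0 < t ->
    is_derive t 1 (f n.+1) (a n.+1 * (f n t - f n.+1 t)).
  exact: hypoexponential_pdfS_derive.
have f_gt0 n t : 0 < t -> 0 < f n t by exact: density_gt0 f0_derive fS_derive n t.
have H_derive n (t : R) : 0 < t -> is_derive t 1 (H n.+1) (f n t).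
  exact: hypoexponential_cdfS_derive.
have H_cvg t : 0 < t -> H n.+1 t @[n --> \oo] --> G t.
  move=> t0; rewrite (cvg_shiftS (H ^~ t)).
  exact: (partial_sum_cdf_cvg F_gt0 Xi0_gt0 tau_exp tau_indep t0).
have mT s := measurable_birth_T_le Xi0 tau s.
have GE s : (G s)%:E = (\int[lebesgue_measure]_(y in `]-oo, s]) (g y)%:E)%E.
  by rewrite -T_density fineK// fin_num_measure.
have G_derive (t : R) : 0 < t -> is_derive t 1 G (g t).
  by move=> t0; apply: Rintegral_density_derive => //; exact: g_cont.
pose u k := (F k)^-1.
have rE n : r n = limn (series (fun k => u k.+1)) - series (fun k => u k.+1) (Xi0 + n)%N.
  by apply/cvg_lim => //; exact: series_tail_cvg.
have r_cvg n : (fun m => \sum_(n.+1 <= k < m.+1) (a k)^-1) @ \oo --> r n.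
  (* Since [a k] is [F (Xi0 + k)], the upper bound [m.+1] becomes [m + Xi0.+1]. *)
  have -> : (fun m => \sum_(n.+1 <= k < m.+1) (a k)^-1) =
      (fun m => \sum_((Xi0 + n).+1 <= k < m) u k) \o (fun m => m + Xi0.+1)%N.
    apply/funext => m /=; rewrite -addnS addnC [in RHS]big_addn.
    rewrite -[in RHS]addSnnS addnK; apply: eq_bigr => k _.
    by rewrite /a /u addnC.
  apply: cvg_comp; first exact: cvg_addnr.
  by rewrite rE; exact: series_tail_cvg.
have r_cvg0 : r @ \oo --> 0.
  rewrite (_ : r = fun n => limn (series (fun k => u k.+1)) -
      series (fun k => u k.+1) (n + Xi0)%N); last first.
    by apply/funext => n; rewrite rE addnC.
  rewrite -(subrr (limn (series (fun k => u k.+1)))).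
  apply: cvgB; first exact: cvg_cst.
  by rewrite (cvg_shiftn Xi0 (series (fun k => u k.+1))); exact: F_sum.
have g_gt0 t : 0 < t -> 0 < g t.
  exact: (limit_gt0 a_gt0 f_cont f0_gt0 fS0 f0_derive fS_derive H_derive H_cvg
    G_derive r_cvg r_cvg0).
have ratioE n t : 0 < t ->
    fine (P [set w | birth_Xi_is Xi0 (fun k => tau k) t (Xi0 + n)%N w]) /
      (g t / F (Xi0 + n)%N) = f n t / g t.
  move=> t0; rewrite (birth_Xi_is_prob F_gt0 Xi0_gt0 tau_exp tau_indep n t0)/=.
  rewrite /f /hypoexponential_pdf invf_div mulrA; congr (_ / _).
  exact: mulrC.
have uniform t0 : 0 < t0 -> forall e, 0 < e -> exists N : nat,
    forall (x : nat) (t : R), (N <= x)%N -> t0 < t ->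
    `| fine (P [set w | birth_Xi_is Xi0 (fun k => tau k) t x w])
         / (g t / F x) - 1 | < e.
  move=> t00 e e0.
  have [N Ne] := density_cvg_uniform a_gt0 f_cont f0_gt0 fS0 f0_derive
    fS_derive H_derive H_cvg G_derive r_cvg r_cvg0 t00 e0.
  exists (Xi0 + N)%N => x t Nx tt.
  have Xi0x : (Xi0 <= x)%N by rewrite (leq_trans _ Nx)// leq_addr.
  rewrite -(subnKC Xi0x) ratioE; last exact: lt_trans tt.
  by apply: Ne; [rewrite -(leq_add2l Xi0) subnKC|exact: ltW].
split; [move=> t t0|exact: uniform|move=> t t0].
  apply/cvgrPdistC_lt => e e0.
  (* The uniform statement concerns times strictly above its threshold, so it is taken at
     [t / 2]. *)
  have t20 : 0 < t / 2 by rewrite divr_gt0.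
  have [N Ne] := uniform _ t20 _ e0.
  by exists N => // x /= Nx; apply: Ne => //; lra.
have GT s : fine (P [set w | (s%:E < birth_T Xi0 (fun k => tau k) w)%E]) = 1 - G s.
  have -> : [set w | (s%:E < birth_T Xi0 (fun k => tau k) w)%E] =
      ~` [set w | (birth_T Xi0 (fun k => tau k) w <= s%:E)%E].
    by apply/seteqP; split => w /=; rewrite ltNge => /negP.
  by rewrite probability_setC// fineB// fin_num_measure.
(* Survival up to [t] has positive probability, at least that of the first holding time exceeding
   [t]. The logarithm is thus differentiable at [t]. *)
have G_lt1 : 0 < 1 - G t.
  have HS n : H n.+1 t <= H n t.
    by rewrite -subr_ge0 -(pmulr_rge0 _ (a_gt0 n)); exact/ltW/f_gt0.
  have H1 : H 1%N t < 1.
    by rewrite -subr_gt0 -(pmulr_rgt0 _ (a_gt0 0%N)); exact: f_gt0.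
  rewrite subr_gt0; apply: le_lt_trans H1.
  apply: (cvgr_to_le (@H_cvg _ t0)); near=> n.
  by elim: (n) => // k; apply: le_trans.
have -> : derive1 (fun s => ln (fine (P [set w |
    (s%:E < birth_T Xi0 (fun k => tau k) w)%E]))) t = - (g t / (1 - G t)).
  under eq_fun do rewrite GT.
  have dG := G_derive t t0.
  have dlnG : is_derive t 1 (@ln R \o (fun s : R => 1 - G s)) ((1 - G t)^-1 * - g t).
    apply: is_derive1_comp; first exact: is_derive1_ln.
    by apply: is_derive_eq; rewrite ?sub0r ?add0r; ring.
  by rewrite derive1E (@derive_val _ _ _ _ _ _ _ dlnG) mulrN mulrC.
rewrite GT.
set v := (fun x : nat => _).
rewrite -(cvg_shiftn Xi0 v).
(* The factor [1 - G t] from the conditioning cancels the one in the logarithmic derivative. *)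
have -> : [sequence v (n + Xi0)%N]_n =
    (fun n => (H n.+1 t - G t) / (g t * r n)).
  apply/funext => n; rewrite /v /= addnC.
  rewrite (birth_Xi_gt_prob F_gt0 Xi0_gt0 tau_exp tau_indep n t0) opprK.
  rewrite -/(H n.+1 t) -/(G t) -/(r n).
  have g0 := g_gt0 t t0.
  rewrite !invfM; move: (r n)^-1 => rn.
  by field; rewrite !gt_eqF.
(* With [H n.+1] in the role of [H n], the relation [fSE] is the definition of the density, hence
   [erefl]. *)
exact: (tail_equivalent a_gt0 f_cont f0_gt0 fS0 f0_derive fS_derive H_derive
  H_cvg G_derive r_cvg r_cvg0 (fun _ _ _ => erefl) t0).
Unshelve. all: by end_near. Qed.
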